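(* Let $K\subseteq\mathbb{R}^n$ be a nonempty closed convex cone, let $c\in\mathbb{R}^n$, $b\in\mathbb{R}^m$, and let $A\in\mathbb{R}^{m\times n}$ have full rank with $m\le n$. Let (P), (D), $p^\star$, $d^\star$, $f$, $g$ be as defined in the context. A point $x^\star\in\mathbb{R}^n$ satisfies $$\mathbf{0}\in\partial f(x^\star)+\partial g(x^\star)$$ if and only if $x^\star$ is a solution to (P), (D) has a solution, and $d^\star=p^\star$.
   Context: A set $K\subseteq\mathbb{R}^n$ is a cone if $K=\lambda K$ for every $\lambda>0$; its dual cone is $K^*=\{u\in\mathbb{R}^n\mid u^Tv\ge 0\text{ for all }v\in K\}$. (P) is the problem: minimize $c^Tx$ subject to $Ax=b$, $x\in K$; its optimal value is $p^\star=\inf\{c^Tx\mid Ax=b,\ x\in K\}$ (with $p^\star=\infty$ if infeasible). (D) is the dual problem: maximize $b^Ty$ subject to $A^Ty+s=c$, $s\in K^*$, over $(y,s)\in\mathbb{R}^m\times\mathbb{R}^n$; its optimal value is $d^\star=\sup\{b^Ty\mid A^Ty+s=c,\ s\in K^*\}$ (with $d^\star=-\infty$ if infeasible). A solution of (P) or (D) is a feasible point attaining the optimal value. The functions $f,g:\mathbb{R}^n\to\mathbb{R}\cup\{\infty\}$ are $f(x)=c^Tx+\delta_{\{x\mid Ax=b\}}(x)$ and $g(x)=\delta_K(x)$, where $\delta_C(x)=0$ if $x\in C$ and $\delta_C(x)=\infty$ if $x\notin C$. The subdifferential of $h:\mathbb{R}^n\to\mathbb{R}\cup\{\infty\}$ at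 $x$ is $\partial h(x)=\{u\in\mathbb{R}^n\mid h(z)\ge h(x)+u^T(z-x)\ \forall z\in\mathbb{R}^n\}$, and the sum of two sets is the Minkowski sum. *)

(* Defs.v *)
From HB Require Import structures.
From mathcomp Require Import all_boot all_order all_algebra.
From mathcomp Require Import all_classical all_reals all_analysis.

Set Implicit Arguments.
Unset Strict Implicit.
Unset Printing Implicit Defensive.

Import Order.TTheory GRing.Theory Num.Theory.
Import numFieldNormedType.Exports.

Local Open Scope classical_set_scope.
Local Open Scope ring_scope.
Local Open Scope ereal_scope.

Definition dotp (R : realType) (n : nat) (u v : 'cV[R]_n) : R :=
  (u^T *m v)%R ord0 ord0.

Definition cone (R : realType) (n : nat) (K : set 'cV[R]_n) : Prop :=
  forall lambda : R, (0 < lambda)%R -> K = [set lambda *: v | v in K].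

Definition dual_cone (R : realType) (n : nat) (K : set 'cV[R]_n) :
    set 'cV[R]_n :=
  [set u | forall v, K v -> (0 <= dotp u v)%R].

Definition primal_feasible (R : realType) (m n : nat) (K : set 'cV[R]_n)
    (A : 'M[R]_(m, n)) (b : 'cV[R]_m) : set 'cV[R]_n :=
  [set x | A *m x = b /\ K x].

(* By the conventions of [ereal_inf], the value is +oo on an empty feasible
   set. *)
Definition primal_value (R : realType) (m n : nat) (K : set 'cV[R]_n)
    (A : 'M[R]_(m, n)) (b : 'cV[R]_m) (c : 'cV[R]_n) : \bar R :=
  ereal_inf [set (dotp c x)%:E | x in primal_feasible K A b].

Definition primal_solution (R : realType) (m n : nat) (K : set 'cV[R]_n)
    (A : 'M[R]_(m, n)) (b : 'cV[R]_m) (c : 'cV[R]_n) : set 'cV[R]_n :=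
  [set x | primal_feasible K A b x /\
           (dotp c x)%:E = primal_value K A b c].

Definition dual_feasible (R : realType) (m n : nat) (K : set 'cV[R]_n)
    (A : 'M[R]_(m, n)) (c : 'cV[R]_n) : set ('cV[R]_m * 'cV[R]_n) :=
  [set ys | (A^T *m ys.1 + ys.2)%R = c /\ dual_cone K ys.2].

(* By the conventions of [ereal_sup], the value is -oo on an empty feasible
   set. *)
Definition dual_value (R : realType) (m n : nat) (K : set 'cV[R]_n)
    (A : 'M[R]_(m, n)) (b : 'cV[R]_m) (c : 'cV[R]_n) : \bar R :=
  ereal_sup [set (dotp b ys.1)%:E | ys in dual_feasible K A c].

Definition dual_solution (R : realType) (m n : nat) (K : set 'cV[R]_n)
    (A : 'M[R]_(m, n)) (b : 'cV[R]_m) (c : 'cV[R]_n) :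
    set ('cV[R]_m * 'cV[R]_n) :=
  [set ys | dual_feasible K A c ys /\
            (dotp b ys.1)%:E = dual_value K A b c].

(* The convex-analytic indicator function, with values 0 and +oo. *)
Definition delta (R : realType) (n : nat) (C : set 'cV[R]_n) (x : 'cV[R]_n) :
    \bar R :=
  if x \in C then 0 else +oo.

Definition primal_f (R : realType) (m n : nat) (A : 'M[R]_(m, n))
    (b : 'cV[R]_m) (c x : 'cV[R]_n) : \bar R :=
  (dotp c x)%:E + delta [set z | A *m z = b] x.

Definition primal_g (R : realType) (n : nat) (K : set 'cV[R]_n)
    (x : 'cV[R]_n) : \bar R :=
  delta K x.

(* Intended for functions that never take the value -oo. Points where [h] is
   +oo are not excluded: there the inequality reads [+oo <= h z]. *)
Definition subdifferential (R : realType) (n : nat) (h : 'cV[R]_n -> \bar R)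
    (x : 'cV[R]_n) : set 'cV[R]_n :=
  [set u | forall z : 'cV[R]_n, h x + (dotp u (z - x)%R)%:E <= h z].

Definition minkowski_sum (R : realType) (n : nat) (S T : set 'cV[R]_n) :
    set 'cV[R]_n :=
  [set (u + v)%R | u in S & v in T].

(* Main.v *)
Require Import Defs.
From mathcomp Require Import all_boot all_order all_algebra.
From mathcomp Require Import all_classical all_reals all_analysis.
From mathcomp Require Import lra.
Import numFieldNormedType.Exports.

Set Implicit Arguments.
Unset Strict Implicit.
Unset Printing Implicit Defensive.

Import Order.TTheory GRing.Theory Num.Theory.

Local Open Scope classical_set_scope.
Local Open Scope ring_scope.

(** Both sides of the equivalence say that [xstar] is primal feasible and that
    some dual feasible pair [(y, s)] satisfies complementary slackness
    [dotp s xstar = 0].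

    The subdifferentials are explicit.  At a point of a cone [K], the
    subgradients of its indicator function are the vectors [- s] with [s] in
    the dual cone and orthogonal to the point ([subdifferential_primal_gP]).
    At a point of the affine space [A x = b], the subgradients of the linear
    objective restricted to that space are [c] plus the normal space of the
    affine space, which is the range of [A^T] ([subdifferential_primal_fP]).
    Neither function has a subgradient outside its effective domain, because
    both domains are nonempty: [K] by assumption, and the affine space because
    [A] has full row rank.  Hence 0 splits as [s + (- s)] with [s = c - A^T y]
    dual feasible and orthogonal to [xstar].

    On the optimization side, the duality gap of a feasible pair is
    [dotp s x >= 0] ([duality_gap]).  A feasible pair with no gap is therefore
    optimal on both sides with equal values; conversely, equal attained values
    mean no gap. *)

(** * The scalar product *)

Section DotProduct.
Context {R : realType} {n : nat}.
Implicit Types u v w : 'cV[R]_n.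

Lemma dotpC u v : dotp u v = dotp v u.
Proof. by rewrite /dotp -[in LHS](trmxK v) -trmx_mul mxE. Qed.

Lemma dotpDr u v w : dotp u (v + w) = dotp u v + dotp u w.
Proof. by rewrite /dotp mulmxDr mxE. Qed.

Lemma dotpNr u v : dotp u (- v) = - dotp u v.
Proof. by rewrite /dotp mulmxN mxE. Qed.

Lemma dotpZr (a : R) u v : dotp u (a *: v) = a * dotp u v.
Proof. by rewrite /dotp -scalemxAr mxE. Qed.

Lemma dotpBr u v w : dotp u (v - w) = dotp u v - dotp u w.
Proof. by rewrite dotpDr dotpNr. Qed.

Lemma dotpDl u v w : dotp (v + w) u = dotp v u + dotp w u.
Proof. by rewrite dotpC dotpDr !(dotpC u). Qed.

Lemma dotpNl u v : dotp (- u) v = - dotp u v.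
Proof. by rewrite dotpC dotpNr dotpC. Qed.

Lemma dotpBl u v w : dotp (v - w) u = dotp v u - dotp w u.
Proof. by rewrite dotpDl dotpNl. Qed.

End DotProduct.

Lemma dotp_trmx {R : realType} {m n : nat} (A : 'M[R]_(m, n)) y x :
  dotp (A^T *m y) x = dotp y (A *m x).
Proof. by rewrite /dotp trmx_mul trmxK mulmxA. Qed.

(** The orthogonal complement of the kernel of [A] is the range of [A^T]: the
    columns of [cokermx A] lie in the kernel, and a row vector killed by
    [cokermx A] is in the row space of [A]. *)
Lemma orthogonal_kernel_range {R : realType} {m n : nat} (A : 'M[R]_(m, n))
    (w : 'cV[R]_n) :
  (forall z : 'cV[R]_n, A *m z = 0 -> dotp w z = 0) ->
  exists y : 'cV[R]_m, w = A^T *m y.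
Proof.
move=> w_ker; have : (w^T <= A)%MS.
  rewrite submxE; apply/eqP/matrixP => i j; rewrite ord1 !mxE.
  have := w_ker (col j (cokermx A)).
  rewrite {1}colE mulmxA mulmx_coker mul0mx => /(_ erefl); apply: etrans.
  by rewrite /dotp mxE; apply: eq_bigr => k _; rewrite !mxE.
by case/submxP => D wD; exists D^T; rewrite -trmx_mul -wD trmxK.
Qed.

(** * Subdifferentials of the two terms of the objective *)

Lemma cone_scale {R : realType} {n : nat} (K : set 'cV[R]_n) (a : R) v :
  cone K -> 0 < a -> K v -> K (a *: v).
Proof. by move=> K_cone a_gt0 Kv; rewrite (K_cone _ a_gt0); exists v. Qed.

Lemma delta_in {R : realType} {n : nat} (C : set 'cV[R]_n) x :
  C x -> delta C x = 0%E.
Proof. by move=> Cx; rewrite /delta mem_set. Qed.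

Lemma delta_notin {R : realType} {n : nat} (C : set 'cV[R]_n) x :
  ~ C x -> delta C x = +oo%E.
Proof. by move=> Cx; rewrite /delta memNset. Qed.

(** The subgradient inequality at a point of value [+oo] would force the
    function to be [+oo] everywhere. *)
Lemma subdifferential_domain {R : realType} {n : nat}
    (h : 'cV[R]_n -> \bar R) (x u z : 'cV[R]_n) :
  subdifferential h x u -> (h z < +oo)%E -> h x <> +oo%E.
Proof.
move=> hu hz hx; have := hu z.
by rewrite hx addye // leye_eq => /eqP hz'; rewrite hz' ltxx in hz.
Qed.

(** Orthogonality of [v] to [x] comes from testing the subgradient inequality
    along the ray through [x], on both sides of [x]. *)
Lemma subdifferential_primal_gP {R : realType} {n : nat} (K : set 'cV[R]_n)
    (x v : 'cV[R]_n) :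
  cone K -> K !=set0 ->
  subdifferential (primal_g K) x v <->
  [/\ K x, dual_cone K (- v) & dotp v x = 0].
Proof.
move=> K_cone [z0 Kz0]; split=> [gv | [Kx Kv vx] z]; last first.
  rewrite /primal_g (delta_in Kx) add0e.
  have [Kz | Kz] := pselect (K z); last by rewrite (delta_notin Kz) leey.
  by rewrite (delta_in Kz) lee_fin dotpBr vx subr0 -oppr_ge0 -dotpNl Kv.
have Kx : K x.
  apply: contrapT => Kx; apply: (subdifferential_domain (z := z0) gv).
    by rewrite /primal_g (delta_in Kz0) ltry.
  by rewrite /primal_g (delta_notin Kx).
have le_vx z : K z -> dotp v z <= dotp v x.
  move=> Kz; have := gv z.
  by rewrite /primal_g !delta_in // add0e lee_fin dotpBr subr_le0.
have vx : dotp v x = 0.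
  have := le_vx _ (cone_scale K_cone (ltr0Sn R 1) Kx).
  have h_gt0 : 0 < 2^-1 :> R by rewrite invr_gt0.
  have := le_vx _ (cone_scale K_cone h_gt0 Kx).
  by rewrite !dotpZr; lra.
by split=> // z Kz; rewrite dotpNl oppr_ge0 -vx le_vx.
Qed.

(** The feasible directions [z] at [x] form the kernel of [A], a linear space,
    so the inequality for [z] and [- z] gives an equality there. *)
Lemma subdifferential_primal_fP {R : realType} {m n : nat}
    (A : 'M[R]_(m, n)) (b : 'cV[R]_m) (c x u : 'cV[R]_n) :
  row_free A ->
  subdifferential (primal_f A b c) x u <->
  A *m x = b /\ exists y : 'cV[R]_m, A^T *m y + u = c.
Proof.
move=> A_free.
have fE z : A *m z = b -> primal_f A b c z = (dotp c z)%:E.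
  by move=> Az; rewrite /primal_f delta_in // adde0.
have fy z : A *m z <> b -> primal_f A b c z = +oo%E.
  by move=> Az; rewrite /primal_f delta_notin.
split=> [fu | [Ax [y yu]] z]; last first.
  have [Az | /fy ->] := pselect (A *m z = b); last exact: leey.
  rewrite !fE // -EFinD lee_fin -yu !dotpDl dotpBr !dotp_trmx Ax Az.
  lra.
have Ax : A *m x = b.
  apply: contrapT => /fy.
  (* A right inverse of [A] provides a point of the affine space. *)
  apply: (subdifferential_domain (z := pinvmx A *m b) fu).
  by rewrite fE ?ltry // mulmxA mulmxVp // mul1mx.
split=> //; have le_uc z : A *m z = 0 -> dotp u z <= dotp c z.
  move=> Az; have := fu (x + z).
  rewrite !fE ?mulmxDr ?Az ?addr0 // -EFinD lee_fin [x + z]addrC addrK.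
  by rewrite dotpDr addrC lerD2r.
have [z Az | y yE] := orthogonal_kernel_range (A := A) (w := c - u).
  have := le_uc (- z); rewrite mulmxN Az oppr0 !dotpNr => /(_ erefl).
  have := le_uc z Az; rewrite dotpBl; lra.
by exists y; rewrite -yE subrK.
Qed.

(** * Duality *)

Section Duality.
Context {R : realType} {m n : nat}.
Context (K : set 'cV[R]_n) (A : 'M[R]_(m, n)) (b : 'cV[R]_m) (c : 'cV[R]_n).

Lemma duality_gap (x : 'cV[R]_n) (ys : 'cV[R]_m * 'cV[R]_n) :
  A *m x = b -> A^T *m ys.1 + ys.2 = c ->
  dotp c x = dotp b ys.1 + dotp ys.2 x.
Proof. by move=> <- <-; rewrite dotpDl dotp_trmx dotpC. Qed.

Lemma weak_duality (x : 'cV[R]_n) (ys : 'cV[R]_m * 'cV[R]_n) :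
  primal_feasible K A b x -> dual_feasible K A c ys ->
  dotp b ys.1 <= dotp c x.
Proof.
move=> [Ax Kx] [ysc ysK]; rewrite (duality_gap Ax ysc) lerDl.
exact: ysK.
Qed.

(** By weak duality the two objective values bound each other's optimum, so
    values that coincide are both optimal. *)
Lemma complementary_slackness (x : 'cV[R]_n) (ys : 'cV[R]_m * 'cV[R]_n) :
  primal_feasible K A b x -> dual_feasible K A c ys ->
  dotp ys.2 x = 0 <->
  [/\ primal_solution K A b c x, dual_solution K A b c ys
    & dual_value K A b c = primal_value K A b c].
Proof.
move=> xP ysD; have gap := duality_gap xP.1 ysD.1.
split=> [ys_x | [[_ xE] [_ ysE] dp]]; last first.
  move: dp; rewrite -xE -ysE => -[] ; rewrite gap; lra.
rewrite ys_x addr0 in gap.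
have xE : (dotp c x)%:E = primal_value K A b c.
  apply/eqP; rewrite eq_le; apply/andP; split; last first.
    by apply: ereal_inf_lbound; exists x.
  apply: le_ereal_inf_tmp => _ [z zP <-].
  by rewrite lee_fin gap weak_duality.
have ysE : (dotp b ys.1)%:E = dual_value K A b c.
  apply/eqP; rewrite eq_le; apply/andP; split.
    by apply: ereal_sup_ubound; exists ys.
  apply: ge_ereal_sup => _ [z zD <-].
  by rewrite lee_fin -gap weak_duality.
by split=> //; rewrite -xE -ysE gap.
Qed.

End Duality.

Theorem theorem2 (R : realType) (m n : nat) (K : set 'cV[R]_n)
    (A : 'M[R]_(m, n)) (b : 'cV[R]_m) (c : 'cV[R]_n)
    (K_nonempty : K !=set0) (K_closed : closed K) (K_convex : convex_set K)
    (K_cone : cone K)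
    (le_mn : (m <= n)%N) (A_full_rank : \rank A = minn m n)
    (xstar : 'cV[R]_n) :
  minkowski_sum (subdifferential (primal_f A b c) xstar)
                (subdifferential (primal_g K) xstar) 0
  <->
  [/\ primal_solution K A b c xstar,
      dual_solution K A b c !=set0
    & dual_value K A b c = primal_value K A b c].
Proof.
have A_free : row_free A by rewrite /row_free A_full_rank (minn_idPl le_mn).
split.
  move=> [s /(subdifferential_primal_fP _ _ _ _ A_free)[Ax [y ysc]]].
  move=> [v /(subdifferential_primal_gP _ _ K_cone K_nonempty)[Kx Kv vx] sv0].
  have vE : - v = s by apply/esym/eqP; rewrite -addr_eq0 sv0.
  rewrite vE in Kv.
  have sx : dotp (y, s).2 xstar = 0 by rewrite /= -vE dotpNl vx oppr0.
  have xP : primal_feasible K A b xstar by [].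
  have ysD : dual_feasible K A c (y, s) by [].
  have [] := (complementary_slackness xP ysD).1 sx.
  by move=> xS ysS dp; split=> //; exists (y, s).
move=> [xS [ys ysS] dp]; have [xP _] := xS; have [ysD _] := ysS.
have [Ax Kx] := xP; have [ysc ysK] := ysD.
have sx : dotp ys.2 xstar = 0.
  by apply/(complementary_slackness xP ysD).
exists ys.2.
  by apply/(subdifferential_primal_fP _ _ _ _ A_free); split=> //; exists ys.1.
exists (- ys.2); last exact: subrr.
apply/(subdifferential_primal_gP _ _ K_cone K_nonempty).
by split; rewrite ?opprK ?dotpNl ?sx ?oppr0.
Qed.
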